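(* For every integer $n\ge0$, let $nov(n)$ (resp. $ov(n)$) be the sum, over all overpartitions of $n$, of the non-overlined (resp. overlined) parts. Then for all $n\ge 0$, $$(n+2)\,nov(n)\equiv (n^2+4n+3)\,ov(n)\pmod 5$$ and $$(n^2+1)\,nov(n)\equiv (4n^3-n^2-1)\,ov(n)\pmod 7.$$
   Context: An overpartition of $n$ is a partition of $n$ in which the first occurrence of each distinct part may be overlined. The sum of non-overlined parts counts each non-overlined part with multiplicity. *)

(* Defs.v *)
From mathcomp Require Import all_boot.
Set Implicit Arguments. Unset Strict Implicit. Unset Printing Implicit Defensive.

(* An overpartition is encoded as a list of (part, overlined?) pairs, written
   in canonical order: parts nonincreasing, and among equal parts the
   overlined copy (if any) comes first.  The "first occurrence" of a
   distinct part is the only one that may be overlined. *)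

Definition op_step (x y : nat * bool) : bool :=
  (y.1 < x.1) || ((y.1 == x.1) && ~~ y.2).

Definition is_overpartition (n : nat) (s : seq (nat * bool)) : bool :=
  [&& all (fun x => 0 < x.1) s,
      sorted op_step s &
      sumn (map fst s) == n].

Fixpoint all_lists (m k : nat) : seq (seq (nat * bool)) :=
  match k with
  | 0 => [:: [::]]
  | k'.+1 => [:: [::]] ++
      [seq x :: s | x <- [seq (i, b) | i <- iota 0 m, b <- [:: false; true]],
                    s <- all_lists m k']
  end.

Definition overpartitions (n : nat) : seq (seq (nat * bool)) :=
  undup [seq s <- all_lists n.+1 n | is_overpartition n s].

Definition nonov_sum (s : seq (nat * bool)) : nat :=
  sumn [seq x.1 | x <- s & ~~ x.2].
Definition ov_sum (s : seq (nat * bool)) : nat :=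
  sumn [seq x.1 | x <- s & x.2].

Definition nov (n : nat) : nat := \sum_(s <- overpartitions n) nonov_sum s.
Definition ov (n : nat) : nat := \sum_(s <- overpartitions n) ov_sum s.

(* Main.v *)
Require Import Defs.
From HB Require Import structures.
From mathcomp Require Import all_boot all_algebra.
From mathcomp Require Import boolp.
From mathcomp Require Import zify ring.
Set Implicit Arguments. Unset Strict Implicit. Unset Printing Implicit Defensive.

(* Let P be the generating function of overpartitions, A and B those of the
   divisor sums over all divisors and over odd divisors, C that of the sums of
   cubes of divisors, theta = q d/dq, and phi the substitution of q^2 for q.
   Removing a part shows that nov and ov have generating functions P A and P B,
   so theta P = P (A + B); moreover B = A - 2 phi A.  Liouville's elementary
   method evaluates A^2, A C, C^2 and B^2 as combinations of Lambert series.
   Modulo 5 the first evaluation makes theta A a polynomial in A.  Modulo 7,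
   Fermat turns the third one into A = C + C^2, and the second one makes
   theta C a polynomial in C.  So each congruence becomes a polynomial identity,
   in A and phi A modulo 5, in C and phi C modulo 7; the second identity holds
   only up to a multiple of the relation between C and phi C given by B^2. *)

(** * The ring of power series *)

Section Series.
Import GRing.Theory.
Local Open Scope ring_scope.

Record series (R : Type) := Series { scoef : nat -> R }.

Variable R : comNzRingType.
Implicit Types f g h : series R.

HB.instance Definition _ := gen_eqMixin (series R).
HB.instance Definition _ := gen_choiceMixin (series R).

Lemma seriesP f g : (forall n, scoef f n = scoef g n) -> f = g.
Proof.
by case: f g => f [g] /= fg; congr Series; apply/funext.
Qed.

Definition sadd f g := Series (fun n => scoef f n + scoef g n).
Definition sopp f := Series (fun n => - scoef f n).
Definition szero := Series (fun _ : nat => 0 : R).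
Definition smul f g :=
  Series (fun n => \sum_(i < n.+1) scoef f i * scoef g (n - i)%N).
Definition sone := Series (fun n => (n == 0%N)%:R : R).

Fact saddA : associative sadd.
Proof. by move=> f g h; apply: seriesP => n /=; rewrite addrA. Qed.
Fact saddC : commutative sadd.
Proof. by move=> f g; apply: seriesP => n /=; rewrite addrC. Qed.
Fact sadd0 : left_id szero sadd.
Proof. by move=> f; apply: seriesP => n /=; rewrite add0r. Qed.
Fact saddN : left_inverse szero sopp sadd.
Proof. by move=> f; apply: seriesP => n /=; rewrite addNr. Qed.

HB.instance Definition _ :=
  GRing.isZmodule.Build (series R) saddA saddC sadd0 saddN.

(** Coefficient n of a product involves only coefficients up to n, so associativity and
    commutativity come from polynomials by truncation. *)
Definition trunc N f : {poly R} := \poly_(i < N) scoef f i.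

Lemma coef_trunc N f n : (n < N)%N -> (trunc N f)`_n = scoef f n.
Proof. by move=> ltnN; rewrite coef_poly ltnN. Qed.

Lemma coef_truncM N f g n :
  (n < N)%N -> (trunc N f * trunc N g)`_n = scoef (smul f g) n.
Proof.
move=> ltnN; rewrite coefM; apply: eq_bigr => i _.
by rewrite !coef_trunc //; have := ltn_ord i; lia.
Qed.

Fact smulA : associative smul.
Proof.
move=> f g h; apply: seriesP => n.
transitivity ((trunc n.+1 f * (trunc n.+1 g * trunc n.+1 h))`_n).
  rewrite coefM; apply: eq_bigr => i _.
  by rewrite coef_trunc ?coef_truncM //; have := ltn_ord i; lia.
rewrite mulrA coefM; apply: eq_bigr => i _.
by rewrite coef_trunc ?coef_truncM //; have := ltn_ord i; lia.
Qed.

Fact smulC : commutative smul.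
Proof.
by move=> f g; apply: seriesP => n; rewrite -!(@coef_truncM n.+1) // mulrC.
Qed.

Fact smul1 : left_id sone smul.
Proof.
move=> f; apply: seriesP => n /=; rewrite big_ord_recl /= mul1r subn0.
by rewrite big1 ?addr0 // => i _; rewrite mul0r.
Qed.

Fact smulDl : left_distributive smul sadd.
Proof.
move=> f g h; apply: seriesP => n /=; rewrite -big_split.
by apply: eq_bigr => i _; rewrite mulrDl.
Qed.

Fact sone_neq0 : sone != 0.
Proof.
apply/eqP => /(congr1 (fun f => scoef f 0)) /= /eqP.
by rewrite oner_eq0.
Qed.

HB.instance Definition _ := GRing.Zmodule_isComNzRing.Build (series R)
  smulA smulC smul1 smulDl sone_neq0.

Lemma scoefD f g n : scoef (f + g) n = scoef f n + scoef g n.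
Proof. by []. Qed.
Lemma scoefN f n : scoef (- f) n = - scoef f n. Proof. by []. Qed.
Lemma scoefM f g n :
  scoef (f * g) n = \sum_(i < n.+1) scoef f i * scoef g (n - i)%N.
Proof. by []. Qed.
Lemma scoef1 n : scoef (1 : series R) n = (n == 0%N)%:R. Proof. by []. Qed.

Lemma scoefMn f m n : scoef (f *+ m) n = scoef f n *+ m.
Proof. by elim: m => // m IHm; rewrite !mulrS scoefD IHm. Qed.

Lemma scoef_natM m f n : scoef (m%:R * f) n = m%:R * scoef f n.
Proof. by rewrite !mulr_natl scoefMn. Qed.

(** Carries characteristic p from coefficients to series, so that identities between series can be
    reduced modulo p as a whole. *)
Lemma series_nat0 p : p%:R = 0 :> R -> p%:R = 0 :> series R.
Proof.
move=> p0; apply: seriesP => n.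
by rewrite scoefMn -mulr_natl p0 mul0r.
Qed.

(** * The derivation q d/dq and the substitution of q^2 for q *)

Definition theta f := Series (fun n => n%:R * scoef f n).

Lemma scoef_theta f n : scoef (theta f) n = n%:R * scoef f n.
Proof. by []. Qed.

Lemma thetaD f g : theta (f + g) = theta f + theta g.
Proof. by apply: seriesP => n /=; rewrite mulrDr. Qed.

Lemma thetaN f : theta (- f) = - theta f.
Proof. by apply: seriesP => n /=; rewrite mulrN. Qed.

Lemma thetaM f g : theta (f * g) = theta f * g + f * theta g.
Proof.
apply: seriesP => n; rewrite scoefD !scoefM /= mulr_sumr -big_split.
apply: eq_bigr => i _ /=.
have -> : n%:R = i%:R + (n - i)%:R :> R by rewrite -natrD subnKC // -ltnS.
by ring.
Qed.

Lemma theta_nat m : theta m%:R = 0.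
Proof.
apply: seriesP => n /=; rewrite scoefMn scoef1.
by case: n => [|n] /=; rewrite ?mul0r // mul0rn mulr0.
Qed.

Lemma theta_natM m f : theta (m%:R * f) = m%:R * theta f.
Proof. by rewrite thetaM theta_nat mul0r add0r. Qed.

Definition dilate f :=
  Series (fun n => if (2 %| n)%N then scoef f (n %/ 2)%N else 0).

Lemma scoef_dilate f n :
  scoef (dilate f) n = if (2 %| n)%N then scoef f (n %/ 2)%N else 0.
Proof. by []. Qed.

Lemma dilateD f g : dilate (f + g) = dilate f + dilate g.
Proof. by apply: seriesP => n /=; case: ifP; rewrite ?addr0. Qed.

Lemma dilateN f : dilate (- f) = - dilate f.
Proof. by apply: seriesP => n /=; case: ifP; rewrite ?oppr0. Qed.

Lemma dilateM f g : dilate (f * g) = dilate f * dilate g.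
Proof.
(* On truncations, [dilate] is composition with the polynomial X^2, hence multiplicative. *)
have trunc_dilate N h i : (i < N)%N ->
    (trunc N h \Po 'X^2)`_i = scoef (dilate h) i.
  move=> ltiN; rewrite coef_comp_poly_Xn //=; case: ifP => // _.
  by rewrite coef_trunc // (leq_ltn_trans (leq_div _ _)).
apply: seriesP => n; rewrite scoefM.
under eq_bigr => i _.
  rewrite -(@trunc_dilate n.+1) // -(@trunc_dilate n.+1 _ (n - i)%N); last first.
    by rewrite ltnS leq_subr.
  over.
rewrite -coefM -comp_polyM coef_comp_poly_Xn //=; case: ifP => // _.
by rewrite coef_truncM // ltnS leq_div.
Qed.

Lemma dilate_natM m f : dilate (m%:R * f) = m%:R * dilate f.
Proof.
apply: seriesP => n; rewrite scoef_natM !scoef_dilate.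
by case: ifP; rewrite ?mulr0 // scoef_natM.
Qed.

Lemma theta_dilate f : theta (dilate f) = 2 * dilate (theta f).
Proof.
apply: seriesP => n; rewrite scoef_natM /= -/(scoef _ _).
case: ifP; last by rewrite !mulr0.
by move=> /divnK {1}<-; rewrite natrM; ring.
Qed.

End Series.

(** * Liouville's method *)

Section BigBij.
Import GRing.Theory.
Local Open Scope ring_scope.

Lemma big_seq_bij (V : nmodType) (T U : eqType) (r : seq T) (s : seq U)
    (h : T -> U) (h' : U -> T) (F : U -> V) :
    uniq r -> uniq s ->
    (forall x, x \in r -> h x \in s /\ h' (h x) = x) ->
    (forall y, y \in s -> h' y \in r /\ h (h' y) = y) ->
  \sum_(y <- s) F y = \sum_(x <- r) F (h x).
Proof.
move=> r_uniq s_uniq hr h's; rewrite -(big_map h xpredT).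
apply: perm_big; apply: uniq_perm => //.
  rewrite map_inj_in_uniq // => x y /hr[_ hx] /hr[_ hy] hxy.
  by rewrite -hx hxy hy.
move=> y; apply/idP/mapP => [/h's[h'y <-]|[x /hr[hx _] ->] //].
by exists (h' y).
Qed.

End BigBij.

(* Unlike [divisors 0 = [:: 1]], [divs 0] is empty. *)
Definition divs n := [seq d <- iota 1 n | d %| n].

Lemma divs_uniq n : uniq (divs n).
Proof. by rewrite filter_uniq ?iota_uniq. Qed.

Lemma mem_divs d n : (d \in divs n) = (0 < n) && (d %| n).
Proof.
rewrite mem_filter mem_iota add1n ltnS andbC.
apply/idP/idP => [/andP[/andP[d0 dn] ->]|/andP[n0 dn]]; first by lia.
by rewrite dn (dvdn_gt0 n0 dn) dvdn_leq.
Qed.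

Section Quads.
Import GRing.Theory.
Local Open Scope ring_scope.

Definition quad_sol (n : nat) (q : nat * nat * nat * nat) : bool :=
  let: (a, b, x, y) := q in
  [&& 0 < a, 0 < b, 0 < x, 0 < y & a * x + b * y == n]%N.

(** Positivity bounds every entry of a solution by n, so this box contains them all; [locked] keeps
    the enumeration from unfolding. *)
Definition quads (n : nat) : seq (nat * nat * nat * nat) :=
  locked [seq q <- [seq (p, y) | p <- [seq (p, x) | p <- [seq (a, b) | a <- iota 0 n.+1,
                                                          b <- iota 0 n.+1],
                                             x <- iota 0 n.+1],
                          y <- iota 0 n.+1] | quad_sol n q].

Lemma quads_uniq n : uniq (quads n).
Proof.
rewrite /quads -lock; apply/filter_uniq/allpairs_uniq; rewrite ?iota_uniq //; last by case=> ? ? [].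
apply/allpairs_uniq; rewrite ?iota_uniq //; last by case=> ? ? [].
by apply/allpairs_uniq; rewrite ?iota_uniq //; case=> ? ? [].
Qed.

Lemma mem_quads n q : (q \in quads n) = quad_sol n q.
Proof.
rewrite /quads -lock mem_filter; case: q => [[[a b] x] y].
case sol: (quad_sol _ _); last by []; rewrite andTb; move: sol => /and5P[a0 b0 x0 y0 /eqP eqn].
apply/allpairsPdep; exists (a, b, x), y; split=> //; last by rewrite mem_iota; nia.
apply/allpairsPdep; exists (a, b), x; split=> //; last by rewrite mem_iota; nia.
by apply/allpairsPdep; exists a, b; split=> //; rewrite mem_iota; nia.
Qed.

Variable V : zmodType.
Implicit Types g k F : nat -> nat -> V.

Definition quad_sum F (P : nat * nat * nat * nat -> bool) n : V :=
  \sum_(q <- [seq q <- quads n | P q]) (let: (a, b, x, y) := q in F a b).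

Lemma quad_sum_bij F G (P Q : nat * nat * nat * nat -> bool) n h h' :
    (forall q, quad_sol n q && Q q -> quad_sol n (h q) && P (h q) /\ h' (h q) = q) ->
    (forall q, quad_sol n q && P q -> quad_sol n (h' q) && Q (h' q) /\ h (h' q) = q) ->
    (forall q, quad_sol n q && Q q ->
      (let: (a, b, x, y) := h q in F a b) = (let: (a, b, x, y) := q in G a b)) ->
  quad_sum F P n = quad_sum G Q n.
Proof.
move=> hQ h'P FG; rewrite /quad_sum.
rewrite (big_seq_bij (r := [seq q <- quads n | Q q]) (h := h) (h' := h')).
- apply: eq_big_seq => q; rewrite mem_filter mem_quads andbC.
  exact: FG.
- by rewrite filter_uniq ?quads_uniq.
- by rewrite filter_uniq ?quads_uniq.
- move=> q; rewrite mem_filter mem_quads mem_filter mem_quads andbC => /hQ.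
  by rewrite andbC.
- move=> q; rewrite mem_filter mem_quads mem_filter mem_quads andbC => /h'P.
  by rewrite andbC.
Qed.

Lemma quad_sum_split F (P Q S : nat * nat * nat * nat -> bool) n :
    (forall q, (P q + Q q + S q = 1)%N) ->
  quad_sum F xpredT n = quad_sum F P n + quad_sum F Q n + quad_sum F S n.
Proof.
move=> PQS; rewrite /quad_sum !big_filter [X in _ = X + _ + _]big_mkcond.
rewrite [X in _ = _ + X + _]big_mkcond [X in _ = _ + _ + X]big_mkcond.
rewrite -!big_split; apply: eq_bigr => q _ /=; have := PQS q.
by case: (P q) (Q q) (S q) => [] [] [] // _; rewrite ?addr0 ?add0r.
Qed.

Lemma quad_sum_swap F (P Q : nat * nat * nat * nat -> bool) n :
    (forall a b, F a b = F b a) ->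
    (forall a b x y, P (b, a, y, x) = Q (a, b, x, y)) ->
  quad_sum F P n = quad_sum F Q n.
Proof.
move=> FC PQ; pose h q : nat * nat * nat * nat :=
  let: (a, b, x, y) := q in (b, a, y, x).
apply: (@quad_sum_bij _ _ _ _ _ h h) => [] [[[a b] x] y] /=; last by [].
  move=> /andP[/and5P[-> -> -> -> /eqP <-] Qq].
  by rewrite PQ Qq addnC eqxx.
move=> /andP[/and5P[-> -> -> -> /eqP <-] Pq].
by rewrite -PQ Pq addnC eqxx.
Qed.

(* The subtractive step (a, b, x, y) |-> (a, a + b, x - y, y) preserves
   a x + b y and exchanges the regions x > y and a < b. *)
Lemma quad_sum_shift g k n :
    (forall a c, k a (a + c)%N = g a c) ->
  quad_sum k (fun q => let: (a, b, x, y) := q in (a < b)%N) n =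
  quad_sum g (fun q => let: (a, b, x, y) := q in (y < x)%N) n.
Proof.
move=> kg.
pose h q : nat * nat * nat * nat := let: (a, b, x, y) := q in
  (a, a + b, x - y, y)%N.
pose h' q : nat * nat * nat * nat := let: (a, b, x, y) := q in
  (a, b - a, x + y, y)%N.
apply: (@quad_sum_bij _ _ _ _ _ h h') => [] [[[a b] x] y] /=.
- move=> /andP[/and5P[a0 b0 x0 y0 /eqP eqn] ltyx]; split; last first.
    by congr (_, _, _, _); lia.
  by apply/andP; split; [apply/and5P; split => //; nia|lia].
- move=> /andP[/and5P[a0 b0 x0 y0 /eqP eqn] ltab]; split; last first.
    by congr (_, _, _, _); lia.
  by apply/andP; split; [apply/and5P; split => //; nia|lia].
- by move=> _; rewrite kg.
Qed.

(** On x = y the equation reads (a + b) x = n: d = a + b is a divisor of n and a runs from 1 to d -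
    1. *)
Lemma quad_sum_diag_r g n :
  quad_sum g (fun q => let: (a, b, x, y) := q in x == y) n =
  \sum_(d <- divs n) \sum_(a <- iota 1 d.-1) g a (d - a)%N.
Proof.
pose r := [seq (d, a) | d <- divs n, a <- iota 1 d.-1].
rewrite -(big_allpairs_dep (h := pair) (F := fun p => g p.2 (p.1 - p.2)%N)).
rewrite /quad_sum.
pose h (p : nat * nat) := (p.2, p.1 - p.2, n %/ p.1, n %/ p.1)%N.
pose h' (q : nat * nat * nat * nat) := let: (a, b, x, y) := q in (a + b, a)%N.
rewrite (big_seq_bij (r := r) (h := h) (h' := h')) //.
- apply: allpairs_uniq_dep; rewrite ?divs_uniq //.
    by move=> *; rewrite iota_uniq.
  by move=> [? ?] [? ?] _ _ [-> ->].
- by rewrite filter_uniq ?quads_uniq.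
- move=> _ /allpairsPdep[d [a [dn + ->]]]; rewrite mem_iota => ad.
  move: dn; rewrite mem_divs => /andP[n0 dn].
  have d0 : (0 < d)%N by lia.
  split; last by rewrite /h /h' /=; congr (_, _); lia.
  rewrite mem_filter /= eqxx mem_quads /=.
  have xd : (0 < n %/ d)%N by rewrite divn_gt0 // dvdn_leq.
  move: xd (esym (divnK dn)); set e := (n %/ d)%N => xd en.
  by apply/and5P; split => //; nia.
- move=> [[[a b] x] y]; rewrite mem_filter mem_quads /=.
  move=> /andP[/eqP <- /and5P[a0 b0 x0 y0 /eqP eqn]].
  have en : n = (x * (a + b))%N by nia.
  split; last by rewrite /h /= en mulnK; [congr (_, _, _, _); lia|lia].
  apply/allpairsPdep; exists (a + b)%N, a; split => //.
    by rewrite mem_divs en dvdn_mull // andbT; nia.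
  by rewrite mem_iota; lia.
Qed.

(** On a = b = d the equation reads d (x + y) = n, which leaves n / d - 1 choices for x. *)
Lemma quad_sum_diag_l k n :
  quad_sum k (fun q => let: (a, b, x, y) := q in a == b) n =
  \sum_(d <- divs n) k d d *+ (n %/ d).-1.
Proof.
pose r := [seq (d, x) | d <- divs n, x <- iota 1 (n %/ d).-1].
transitivity (\sum_(p <- r) k p.1 p.1); last first.
  rewrite big_allpairs_dep; apply: eq_bigr => d _ /=.
  by rewrite big_const_seq count_predT size_iota iter_addr_0.
rewrite /quad_sum.
pose h (p : nat * nat) := (p.1, p.1, p.2, n %/ p.1 - p.2)%N.
pose h' (q : nat * nat * nat * nat) := let: (a, b, x, y) := q in (a, x)%N.
rewrite (big_seq_bij (r := r) (h := h) (h' := h')) //.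
- apply: allpairs_uniq_dep; rewrite ?divs_uniq //.
    by move=> *; rewrite iota_uniq.
  by move=> [? ?] [? ?] _ _ [-> ->].
- by rewrite filter_uniq ?quads_uniq.
- move=> _ /allpairsPdep[d [x [dn + ->]]]; rewrite mem_iota => xd.
  move: dn; rewrite mem_divs => /andP[n0 dn].
  have d0 : (0 < d)%N by apply: dvdn_gt0 dn.
  split => //.
  rewrite mem_filter /= eqxx mem_quads /=.
  move: xd (esym (divnK dn)); set e := (n %/ d)%N => xd en.
  by apply/and5P; split => //; nia.
- move=> [[[a b] x] y]; rewrite mem_filter mem_quads /=.
  move=> /andP[/eqP <- /and5P[a0 b0 x0 y0 /eqP eqn]].
  have en : n = ((x + y) * a)%N by nia.
  split; last by rewrite /h /= en mulnK //; congr (_, _, _, _); lia.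
  apply/allpairsPdep; exists a, x; split => //.
    by rewrite mem_divs en dvdn_mull // andbT; nia.
  by rewrite mem_iota en mulnK; lia.
Qed.

(** Cut the sum of g along x > y, x < y, x = y and that of k along a < b, a > b, a = b. The two
    off-diagonal pieces of each agree by symmetry, and the subtractive step matches those of g with
    those of k, so only the diagonals survive. *)
Lemma quad_sum_liouville g k n :
    (forall a b, g a b = g b a) -> (forall a b, k a b = k b a) ->
    (forall a c, k a (a + c)%N = g a c) ->
  quad_sum (fun a b => g a b - k a b) xpredT n =
    \sum_(d <- divs n) \sum_(a <- iota 1 d.-1) g a (d - a)%N
    - \sum_(d <- divs n) k d d *+ (n %/ d).-1.
Proof.
move=> gC kC kg.
transitivity (quad_sum g xpredT n - quad_sum k xpredT n).
  rewrite /quad_sum -sumrN -big_split /=.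
  by apply: eq_bigr => [] [[[a b] x] y].
rewrite -quad_sum_diag_l -quad_sum_diag_r.
rewrite (@quad_sum_split g (fun q => let: (a, b, x, y) := q in y < x)%N
  (fun q => let: (a, b, x, y) := q in x < y)%N
  (fun q => let: (a, b, x, y) := q in x == y)); last first.
  by move=> [[[a b] x] y]; case: ltngtP.
rewrite (@quad_sum_split k (fun q => let: (a, b, x, y) := q in a < b)%N
  (fun q => let: (a, b, x, y) := q in b < a)%N
  (fun q => let: (a, b, x, y) := q in a == b)); last first.
  by move=> [[[a b] x] y]; case: ltngtP.
rewrite (@quad_sum_swap g (fun q => let: (a, b, x, y) := q in x < y)%N
  (fun q => let: (a, b, x, y) := q in y < x)%N) //.
rewrite (@quad_sum_swap k (fun q => let: (a, b, x, y) := q in b < a)%N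
  (fun q => let: (a, b, x, y) := q in a < b)%N) //.
rewrite (quad_sum_shift n kg).
by rewrite opprD addrA; congr (_ - _); rewrite addrAC subrr add0r.
Qed.

End Quads.

(** * Lambert series *)

Section Lambert.
Import GRing.Theory.
Local Open Scope ring_scope.

Variable R : comNzRingType.
Implicit Types f g k : nat -> R.

Definition lambert f := Series (fun n => \sum_(d <- divs n) f d).

Definition quad_series (F : nat -> nat -> R) := Series (quad_sum F xpredT).

Lemma eq_lambert f g : (forall d, (0 < d)%N -> f d = g d) ->
  lambert f = lambert g.
Proof.
move=> fg; apply: seriesP => n /=; apply: eq_big_seq => d.
by rewrite mem_divs => /andP[n0 /(dvdn_gt0 n0)]; apply: fg.
Qed.

Lemma lambertD f g : lambert f + lambert g = lambert (fun d => f d + g d).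
Proof. by apply: seriesP => n; rewrite scoefD /= big_split. Qed.

Lemma lambertN f : - lambert f = lambert (fun d => - f d).
Proof. by apply: seriesP => n; rewrite scoefN /= sumrN. Qed.

Lemma lambert_natM m f : m%:R * lambert f = lambert (fun d => m%:R * f d).
Proof. by apply: seriesP => n; rewrite scoef_natM /= mulr_sumr. Qed.

(** Doubling maps the divisors of n / 2 onto the even divisors of n; an odd n has no even
    divisor. *)
Lemma dilate_lambert f :
  dilate (lambert f) =
  lambert (fun d => if (2 %| d)%N then f (d %/ 2)%N else 0).
Proof.
apply: seriesP => n; rewrite scoef_dilate /= -big_mkcond; case: ifP => [n2|n2].
  rewrite -[RHS]big_filter; symmetry.
  rewrite (big_seq_bij (r := divs (n %/ 2)) (h := muln 2) (h' := divn^~ 2)).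
  - by apply: eq_bigr => d _; rewrite mulKn.
  - exact: divs_uniq.
  - by rewrite filter_uniq ?divs_uniq.
  - move=> d; rewrite mem_divs mem_filter mem_divs mulKn // => /andP[n0 dn].
    split=> //; rewrite dvdn_mulr //=.
    rewrite -[X in (_ %| X)%N](divnK n2) mulnC dvdn_pmul2r // dn.
    by move: n0; rewrite divn_gt0 // => /ltnW ->.
  - move=> d; rewrite mem_filter !mem_divs => /and3P[d2 n0 dn].
    rewrite mulnC divnK // divn_gt0 // dvdn_leq // dvdn_divRL //.
    by rewrite divnK.
rewrite big_seq_cond big_pred0 // => d; rewrite mem_divs.
by apply/negP => /andP[/andP[_ dn] d2]; rewrite (dvdn_trans d2 dn) in n2.
Qed.

(** For i + j = n, a dividing i and b dividing j, the cofactors x and y satisfy a x + b y = n. The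
    terms with i or j zero vanish because [divs 0] is empty, in accordance with x, y > 0. *)
Lemma lambertM f g :
  lambert f * lambert g = quad_series (fun a b => f a * g b).
Proof.
apply: seriesP => n; rewrite scoefM /= /quad_sum filter_predT.
pose r := [seq (i, p) | i <- iota 0 n.+1,
                        p <- [seq (a, b) | a <- divs i, b <- divs (n - i)]].
transitivity (\sum_(p <- r) f p.2.1 * g p.2.2).
  rewrite big_allpairs_dep -[iota 0 n.+1]/(index_iota 0 n.+1) big_mkord.
  by apply: eq_bigr => i _; rewrite big_allpairs_dep big_distrlr.
pose h (q : nat * nat * nat * nat) :=
  let: (a, b, x, y) := q in ((a * x)%N, (a, b)).
pose h' (p : nat * (nat * nat)) :=
  (p.2.1, p.2.2, p.1 %/ p.2.1, (n - p.1) %/ p.2.2)%N.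
rewrite (big_seq_bij (r := quads n) (h := h) (h' := h')).
- by apply: eq_bigr => [] [[[a b] x] y].
- exact: quads_uniq.
- apply: allpairs_uniq_dep; rewrite ?iota_uniq //.
    move=> i _; apply: allpairs_uniq; rewrite ?divs_uniq //.
    by move=> [? ?] [? ?] _ _ [-> ->].
  by move=> [? ?] [? ?] _ _ [-> ->].
- move=> [[[a b] x] y]; rewrite mem_quads /=.
  move=> /and5P[a0 b0 x0 y0 /eqP eqn].
  have en : (n - a * x = b * y)%N by lia.
  split; last by rewrite /h' /= en !mulKn.
  apply/allpairsPdep; exists (a * x)%N, (a, b); rewrite mem_iota; split=> //.
    by lia.
  apply/allpairsPdep; exists a, b.
  by rewrite en !mem_divs !dvdn_mulr // !muln_gt0 a0 b0 x0 y0.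
- move=> _ /allpairsPdep[i [_ [ilt /allpairsPdep[a [b [ai bi ->]]] ->]]].
  move: ilt ai bi; rewrite mem_iota !mem_divs => ilt /andP[i0 ai] /andP[j0 bj].
  rewrite mem_quads /h /h' /= ![(_ * (_ %/ _))%N]mulnC !divnK //.
  have [a0 b0] := (dvdn_gt0 i0 ai, dvdn_gt0 j0 bj).
  have x0 : (0 < i %/ a)%N by rewrite divn_gt0 // dvdn_leq.
  have y0 : (0 < (n - i) %/ b)%N by rewrite divn_gt0 // dvdn_leq.
  by rewrite a0 b0 x0 y0 subnKC ?eqxx.
Qed.

Lemma eq_quad_series (F G : nat -> nat -> R) :
  (forall a b, F a b = G a b) -> quad_series F = quad_series G.
Proof.
move=> FG; apply: seriesP => n; apply: eq_bigr => [] [[[a b] x] y] _.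
exact: FG.
Qed.

Lemma quad_seriesD F G :
  quad_series (fun a b => F a b + G a b) = quad_series F + quad_series G.
Proof.
apply: seriesP => n; rewrite scoefD /= /quad_sum -big_split.
by apply: eq_bigr => [] [[[a b] x] y].
Qed.

Lemma quad_series_natM m F :
  quad_series (fun a b => m%:R * F a b) = m%:R * quad_series F.
Proof.
apply: seriesP => n; rewrite scoef_natM /= /quad_sum mulr_sumr.
by apply: eq_bigr => [] [[[a b] x] y].
Qed.

(* Symmetric functions of a^2, b^2, (a + b)^2 that are polynomials in a and b
   yield admissible pairs: K comes from G by changing the sign of b. *)
Lemma quad_series_liouville (G K : nat -> nat -> R) k :
    (forall a b, G a b = G b a) -> (forall a b, K a b = K b a) ->
    (forall a c, K a (a + c)%N = G a c) ->
    (forall d, G 0%N d = d%:R * k d) ->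
  quad_series (fun a b => G a b - K a b) =
  lambert (fun d => \sum_(a < d) G a (d - a)%N) - theta (lambert k).
Proof.
move=> GC KC KG Gk; apply: seriesP => n.
rewrite scoefD scoefN /= (quad_sum_liouville _ GC KC KG) mulr_sumr -!sumrB.
apply: eq_big_seq => d; rewrite mem_divs => /andP[n0 dn].
have d0 := dvdn_gt0 n0 dn.
have q0 : (0 < n %/ d)%N by rewrite divn_gt0 // dvdn_leq.
rewrite -(big_mkord xpredT (fun a => G a (d - a)%N)) /index_iota subn0.
case: d d0 dn q0 => // d _ dn q0.
rewrite -[iota 0 d.+1]/(0%N :: iota 1 d) big_cons subn0 Gk.
(* Writing d for [d.+1], the diagonal term is (n / d - 1) d k(d) = n k(d) - d k(d): the first part
   belongs to theta, the second supplies the term a = 0 of the sum. *)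
have -> : K d.+1 d.+1 = d.+1%:R * k d.+1.
  by rewrite -[X in K _ X]addn0 KG GC Gk.
have q1 : (n %/ d.+1).-1%:R = (n %/ d.+1)%:R - 1 :> R by rewrite -subn1 natrB.
have nR : n%:R = (n %/ d.+1)%:R * d.+1%:R :> R by rewrite -natrM divnK.
rewrite -[X in _ - X = _]mulr_natr q1 nR.
by ring.
Qed.

(** * Quadratic relations between divisor-sum series *)

Definition sigma_series m := lambert (fun d => d%:R ^+ m).

(** This is B, while [sigma_series 1] is A and [sigma_series 3] is C. *)
Definition odd_sigma_series := lambert (fun d => if odd d then d%:R else 0).

Let natrB_ord d (a : 'I_d) : (d - a)%:R = d%:R - a%:R :> R.
Proof. by rewrite natrB // ltnW. Qed.

(** Besge's formula. G is half of a^2 + b^2 + (a + b)^2, and G - K = 2 a b; the factor 12 clears the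
    denominators of the power sums. *)
Lemma sigma1_sqr : 12 * sigma_series 1 ^+ 2 =
  5 * sigma_series 3 + sigma_series 1 - 6 * theta (sigma_series 1).
Proof.
pose G (a b : nat) : R := a%:R ^+ 2 + a%:R * b%:R + b%:R ^+ 2.
pose K (a b : nat) : R := a%:R ^+ 2 - a%:R * b%:R + b%:R ^+ 2.
have GK := @quad_series_liouville G K (fun d => d%:R ^+ 1).
(* Separating the number of terms m from D permits induction on m; afterwards both become d. *)
have sumG (m : nat) (D : R) :
    6 * (\sum_(a < m) (a%:R ^+ 2 + a%:R * (D - a%:R) + (D - a%:R) ^+ 2)) =
    6 * m%:R * D ^+ 2 - 3 * m%:R * (m%:R - 1) * D
    + m%:R * (m%:R - 1) * (2 * m%:R - 1).
  elim: m => [|m IHm]; first by rewrite big_ord0; ring.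
  by rewrite big_ord_recr /= mulrDr IHm -natr1; ring.
transitivity (6 * (2 * (sigma_series 1 * sigma_series 1))); first by ring.
rewrite lambertM -quad_series_natM.
rewrite (@eq_quad_series _ (fun a b => G a b - K a b)); last first.
  by move=> a b; rewrite /G /K; ring.
rewrite GK; first last.
- by move=> d; rewrite /G; ring.
- by move=> a c; rewrite /G /K natrD; ring.
- by move=> a b; rewrite /K; ring.
- by move=> a b; rewrite /G; ring.
rewrite mulrBr; congr (_ - _); rewrite !lambert_natM lambertD.
apply: eq_lambert => d _; rewrite /G.
by under eq_bigr => a _ do rewrite natrB_ord; rewrite sumG; ring.
Qed.

(** G is now the square of the previous form, so G - K = 4 (a^3 b + a b^3). In Eisenstein series
    this is Ramanujan's 3 theta E4 = E2 E4 - E6. *)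
Lemma sigma1_sigma3 : 240 * (sigma_series 1 * sigma_series 3) =
  21 * sigma_series 5 + 10 * sigma_series 3 - sigma_series 1
  - 30 * theta (sigma_series 3).
Proof.
pose G (a b : nat) : R := (a%:R ^+ 2 + a%:R * b%:R + b%:R ^+ 2) ^+ 2.
pose K (a b : nat) : R := (a%:R ^+ 2 - a%:R * b%:R + b%:R ^+ 2) ^+ 2.
have GK := @quad_series_liouville G K (fun d => d%:R ^+ 3).
have sumG (m : nat) (D : R) :
    30 * (\sum_(a < m) (a%:R ^+ 2 + a%:R * (D - a%:R) + (D - a%:R) ^+ 2) ^+ 2) =
    30 * D ^+ 4 * m%:R - 30 * D ^+ 3 * m%:R * (m%:R - 1)
    + 15 * D ^+ 2 * m%:R * (m%:R - 1) * (2 * m%:R - 1)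
    - 15 * D * m%:R ^+ 2 * (m%:R - 1) ^+ 2
    + m%:R * (m%:R - 1) * (2 * m%:R - 1) * (3 * m%:R ^+ 2 - 3 * m%:R - 1).
  elim: m => [|m IHm]; first by rewrite big_ord0; ring.
  by rewrite big_ord_recr /= mulrDr IHm -natr1; ring.
transitivity (30 * (4 * (sigma_series 3 * sigma_series 1
                         + sigma_series 1 * sigma_series 3))); first by ring.
rewrite !lambertM -quad_seriesD -quad_series_natM.
rewrite (@eq_quad_series _ (fun a b => G a b - K a b)); last first.
  by move=> a b; rewrite /G /K; ring.
rewrite GK; first last.
- by move=> d; rewrite /G; ring.
- by move=> a c; rewrite /G /K natrD; ring.
- by move=> a b; rewrite /K; ring.
- by move=> a b; rewrite /G; ring.
(* Unfocused rewriting would try to unify the numerals 30, 21 and 10. *)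
rewrite [LHS]mulrBr; congr (_ - _); rewrite [LHS]lambert_natM.
rewrite [X in _ = X + _ + _]lambert_natM [X in _ = _ + X + _]lambert_natM.
rewrite lambertN !lambertD.
apply: eq_lambert => d _; rewrite /G.
by under eq_bigr => a _ do rewrite natrB_ord; rewrite sumG; ring.
Qed.

(** Here G - K = 4 a^3 b^3, and G(0, d) = 0 removes the theta term. In Eisenstein series this is
    E4^2 = E8. *)
Lemma sigma3_sqr :
  120 * sigma_series 3 ^+ 2 = sigma_series 7 - sigma_series 3.
Proof.
pose G (a b : nat) : R := (a%:R * b%:R * (a%:R + b%:R)) ^+ 2.
pose K (a b : nat) : R := (a%:R * b%:R * (a%:R - b%:R)) ^+ 2.
have GK := @quad_series_liouville G K (fun d => 0).
have sumG (m : nat) (D : R) :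
    30 * (\sum_(a < m) (a%:R * (D - a%:R) * (a%:R + (D - a%:R))) ^+ 2) =
    D ^+ 2 * (5 * D ^+ 2 * m%:R * (m%:R - 1) * (2 * m%:R - 1)
    - 15 * D * m%:R ^+ 2 * (m%:R - 1) ^+ 2
    + m%:R * (m%:R - 1) * (2 * m%:R - 1) * (3 * m%:R ^+ 2 - 3 * m%:R - 1)).
  elim: m => [|m IHm]; first by rewrite big_ord0; ring.
  by rewrite big_ord_recr /= mulrDr IHm -natr1; ring.
transitivity (30 * (4 * (sigma_series 3 * sigma_series 3))); first by ring.
rewrite lambertM -quad_series_natM.
rewrite (@eq_quad_series _ (fun a b => G a b - K a b)); last first.
  by move=> a b; rewrite /G /K; ring.
rewrite GK; first last.
- by move=> d; rewrite /G; ring.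
- by move=> a c; rewrite /G /K natrD; ring.
- by move=> a b; rewrite /K; ring.
- by move=> a b; rewrite /G; ring.
have -> : theta (lambert (fun=> 0)) = 0.
  by apply: seriesP => n /=; rewrite big1_eq mulr0.
rewrite subr0 !lambert_natM lambertN !lambertD.
apply: eq_lambert => d _; rewrite /G.
by under eq_bigr => a _ do rewrite natrB_ord; rewrite sumG; ring.
Qed.

Lemma odd_sigma_sqr :
  12 * odd_sigma_series ^+ 2 =
  sigma_series 3 + 4 * dilate (sigma_series 3) - odd_sigma_series.
Proof.
(* G(a, b) is the square of the even one among a, b and a + b when there is only
   one, and 0 otherwise; G - K is then supported on pairs of odd numbers. *)
pose L s (a b : nat) : R := if odd a then
    if odd b then (a%:R + s * b%:R) ^+ 2 else b%:R ^+ 2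
  else if odd b then a%:R ^+ 2 else 0.
have GK := @quad_series_liouville (L 1) (L (-1)) (fun d => 0).
transitivity (3 * (4 * (odd_sigma_series * odd_sigma_series))); first by ring.
rewrite lambertM -quad_series_natM.
rewrite (@eq_quad_series _ (fun a b => L 1 a b - L (-1) a b)); last first.
  by move=> a b; rewrite /L; case: (odd a); case: (odd b); ring.
rewrite GK; first last.
- by move=> d; rewrite /L /=; case: (odd d); ring.
- move=> a c; rewrite /L oddD natrD.
  by case: (odd a); case: (odd c) => /=; ring.
- by move=> a b; rewrite /L; case: (odd a); case: (odd b); ring.
- by move=> a b; rewrite /L; case: (odd a); case: (odd b); ring.
have -> : theta (lambert (fun=> 0)) = 0.
  by apply: seriesP => n /=; rewrite big1_eq mulr0.
rewrite subr0 dilate_lambert !lambert_natM lambertN !lambertD.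
apply: eq_lambert => d _.
(* The parities of a and d - a have period 2 in a. For even d each pair of terms gives d^2; for odd
   d it gives the squares of the even members, and a = d - 1 remains unpaired. *)
have sum_pairs (F : nat -> R) m :
    \sum_(a < m.*2) F a = \sum_(i < m) (F i.*2 + F i.*2.+1).
  elim: m => [|m IHm]; first by rewrite !big_ord0.
  by rewrite doubleS !big_ord_recr /= IHm addrA.
have [e [->|->]] : exists e, d = e.*2 \/ d = e.*2.+1.
  by exists d./2; case: (boolP (odd d)) => od; [right|left]; lia.
- rewrite (sum_pairs (fun a => L 1 a (e.*2 - a)%N)).
  rewrite odd_double -muln2 mulnK // dvdn_mull // muln2.
  rewrite (eq_bigr (fun=> (e.*2)%:R ^+ 2)) => [|i _].
    by rewrite sumr_const card_ord -mulr_natr -muln2 natrM; ring.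
  have ie := ltn_ord i.
  have -> : (e.*2 - i.*2.+1 = (e - i.+1).*2.+1)%N by lia.
  have -> : (e.*2 - i.*2 = (e - i).*2)%N by lia.
  rewrite /L /= !odd_double /= add0r mul1r -natrD.
  by congr (_%:R ^+ 2); lia.
have sumF (m : nat) (D : R) :
    3 * (\sum_(i < m) (4 * i%:R ^+ 2 + 4 * (D - i%:R) ^+ 2)) =
    4 * m%:R * (m%:R - 1) * (2 * m%:R - 1) - 12 * D * m%:R * (m%:R - 1)
    + 12 * D ^+ 2 * m%:R.
  elim: m => [|m IHm]; first by rewrite big_ord0; ring.
  by rewrite big_ord_recr /= mulrDr IHm -natr1; ring.
rewrite big_ord_recr /= (sum_pairs (fun a => L 1 a (e.*2.+1 - a)%N)).
rewrite (eq_bigr (fun i : 'I_e => 4 * i%:R ^+ 2 + 4 * (e%:R - i%:R) ^+ 2)).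
  rewrite subSnn mulrDr sumF dvdn2 /= odd_double /= /L odd_double /=.
  by rewrite -natr1 -muln2 natrM; ring.
move=> i _; have ie := ltn_ord i.
have -> : (e.*2.+1 - i.*2.+1 = (e - i).*2)%N by lia.
have -> : (e.*2.+1 - i.*2 = (e - i).*2.+1)%N by lia.
rewrite /L /= !odd_double /= -!muln2 !natrM natrB_ord.
by ring.
Qed.

Lemma odd_sigmaE :
  odd_sigma_series = sigma_series 1 - 2 * dilate (sigma_series 1).
Proof.
rewrite dilate_lambert !lambert_natM lambertN lambertD.
apply: eq_lambert => d _; rewrite dvdn2; case: (boolP (odd d)) => od /=.
  by ring.
have -> : d%:R = 2 * (d %/ 2)%:R :> R by rewrite -natrM; congr _%:R; lia.
by ring.
Qed.

End Lambert.

(** * Generating functions of overpartitions *)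

Section Overpartitions.

Implicit Types (x y : nat * bool) (s t : seq (nat * bool)).

(** [op_step] does not relate an overlined part to itself; adding equality gives a total order, so
    each multiset of parts has exactly one sorted list. *)
Definition op_le x y := op_step x y || (x == y).

Lemma op_le_total : total op_le.
Proof.
move=> [a b] [c d]; rewrite /op_le /op_step -!pair_eqE /=.
by case: b; case: d; case: ltngtP.
Qed.

Lemma op_le_anti : antisymmetric op_le.
Proof.
move=> [a b] [c d]; rewrite /op_le /op_step -!pair_eqE /=.
by case: b; case: d; case: ltngtP => //= ->.
Qed.

Lemma op_step_trans : transitive op_step.
Proof.
move=> [a b] [c d] [e f]; rewrite /op_step /=.
by case: b; case: d; case: f => /=; lia.
Qed.

Lemma op_le_trans : transitive op_le.
Proof.
move=> y x z /orP[xy|/eqP->//] /orP[yz|/eqP<-]; rewrite /op_le ?xy //.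
by rewrite (op_step_trans xy yz).
Qed.

(** The irreflexivity of [op_step] at overlined parts is what forbids repeating them; this splits
    off as a condition independent of the order. *)
Lemma sorted_op_stepE s :
  sorted op_step s = sorted op_le s && uniq [seq x <- s | x.2].
Proof.
rewrite (sorted_pairwise op_step_trans) (sorted_pairwise op_le_trans).
elim: s => //= x s ->.
have -> : all (op_step x) s = all (op_le x) s && (x.2 ==> (x \notin s)).
  elim: s => [|y s IHs] /=; first by rewrite implybT.
  rewrite IHs in_cons; case: x y {IHs} => [a b] [c d].
  rewrite /op_le /op_step -!pair_eqE /=.
  by case: b; case: d; case: ltngtP => //=; rewrite ?andbF.
case x2: x.2 => /=; last by rewrite andbT andbA.
by rewrite mem_filter x2 andbACA.
Qed.

Definition op_content n s :=
  [&& all (fun x => 0 < x.1) s, uniq [seq x <- s | x.2] & sumn (map fst s) == n].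

Lemma perm_op_content n s t : perm_eq s t -> op_content n s = op_content n t.
Proof.
move=> st; rewrite /op_content (perm_all _ st) (perm_sumn (perm_map fst st)).
by rewrite (perm_uniq (perm_filter _ st)).
Qed.

Lemma mem_all_lists m k s :
  all (fun x => x.1 < m) s -> size s <= k -> s \in all_lists m k.
Proof.
elim: k s => [|k IHk] [|[i b] s] // /andP[im sm] sk.
rewrite -[all_lists m k.+1]/([::] :: [seq x :: s |
  x <- [seq (i, b) | i <- iota 0 m, b <- [:: false; true]], s <- all_lists m k]).
apply/mem_behead/allpairsPdep; exists (i, b), s; split=> //.
  by apply/allpairsPdep; exists i, b; rewrite mem_iota; split; rewrite ?inE; case: (b).
exact: IHk.
Qed.

Lemma mem_overpartitions n s :
  (s \in overpartitions n) = sorted op_le s && op_content n s.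
Proof.
rewrite mem_undup mem_filter /is_overpartition sorted_op_stepE /op_content.
have [s0 /=|] := boolP (all _ s); last by rewrite !andbF.
have [/eqP sn|] := boolP (sumn _ == n); last by rewrite !andbF.
(* By positivity, the parts and their number are at most n, so the bounded enumeration misses
   nothing. *)
rewrite !andbT mem_all_lists ?andbT // -sn.
  apply/allP => x xs; rewrite ltnS (perm_sumn (perm_map fst (perm_to_rem xs))).
  exact: leq_addr.
elim: s s0 {sn} => //= x s IHs /andP[x0 s0].
by rewrite -add1n leq_add // IHs.
Qed.

Lemma overpartitions_uniq n : uniq (overpartitions n).
Proof. exact: undup_uniq. Qed.

Lemma overpartition_sumn n s : s \in overpartitions n -> sumn (map fst s) = n.
Proof. by rewrite mem_overpartitions => /and4P[_ _ _ /eqP]. Qed.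

Lemma mem_overpartition_part n s x :
  s \in overpartitions n -> x \in s -> 0 < x.1 <= n.
Proof.
move=> sn xs; rewrite -(overpartition_sumn sn).
rewrite (perm_sumn (perm_map fst (perm_to_rem xs))) leq_addr andbT.
by move: sn; rewrite mem_overpartitions => /and4P[_ /allP/(_ _ xs)].
Qed.

Lemma sorted_op_le_eq s t :
  sorted op_le s -> sorted op_le t -> perm_eq s t -> s = t.
Proof. exact: (sorted_eq op_le_trans op_le_anti). Qed.

Lemma op_content_cons n x s : 0 < x.1 -> x.1 <= n ->
  op_content n (x :: s) = op_content (n - x.1) s && (x.2 ==> (x \notin s)).
Proof.
move=> x0 xn; rewrite /op_content /= x0 /=.
have -> : (x.1 + sumn (map fst s) == n) = (sumn (map fst s) == n - x.1) by lia.
case x2: x.2 => /=; last by rewrite andbT.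
by rewrite mem_filter x2 /=; case: (x \in s); rewrite ?andbF ?andbT.
Qed.

(** Deleting one copy of x is a bijection whose inverse inserts x and sorts; an overlined x can be
    inserted only where it is absent. *)
Lemma big_overpartitions_mem (V : nmodType) n x (F : nat -> V) :
    0 < x.1 -> x.1 <= n ->
  (\sum_(s <- overpartitions n | x \in s) F (count_mem x s) =
   \sum_(s <- overpartitions (n - x.1) | x.2 ==> (x \notin s))
     F (count_mem x s).+1)%R.
Proof.
move=> x0 xn; rewrite -big_filter -[RHS]big_filter.
rewrite (big_seq_bij
  (r := [seq s <- overpartitions (n - x.1) | x.2 ==> (x \notin s)])
  (h := fun t => sort op_le (x :: t)) (h' := rem x)).
- apply: eq_bigr => s _; congr F.
  by rewrite (permP (permEl (perm_sort _ _))) /= eqxx.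
- by rewrite filter_uniq ?overpartitions_uniq.
- by rewrite filter_uniq ?overpartitions_uniq.
- move=> t; rewrite !mem_filter !mem_overpartitions.
  move=> /andP[xt /andP[t_sorted tn]].
  have st := permEl (perm_sort op_le (x :: t)).
  rewrite mem_sort mem_head sort_sorted; last exact: op_le_total.
  rewrite (perm_op_content _ st) op_content_cons // tn xt; split=> //.
  apply: sorted_op_le_eq => //.
    apply: (subseq_sorted op_le_trans (rem_subseq _ _)).
    exact/sort_sorted/op_le_total.
  rewrite -(perm_cons x) -(permPl (perm_to_rem _)) ?st //.
  by rewrite mem_sort mem_head.
- move=> s; rewrite !mem_filter !mem_overpartitions.
  move=> /andP[xs /andP[s_sorted]].
  rewrite (perm_op_content _ (perm_to_rem xs)) op_content_cons //.
  move=> /andP[-> ->]; split.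
    by rewrite andbT /=; apply: (subseq_sorted op_le_trans (rem_subseq _ _)).
  apply: sorted_op_le_eq => //; first exact/sort_sorted/op_le_total.
  by rewrite perm_sort perm_sym perm_to_rem.
Qed.

(** * Generating series of multiplicities and of part sums *)

Import GRing.Theory.
Local Open Scope ring_scope.

Variable R : comNzRingType.

Definition op_series : series R := Series (fun n => (size (overpartitions n))%:R).

Definition count_series x : series R :=
  Series (fun n => \sum_(s <- overpartitions n) (count_mem x s)%:R).

(** Multiplication by q^k. *)
Definition shift k (f : series R) :=
  Series (fun n => if (n < k)%N then 0 else scoef f (n - k)%N).

Lemma scoef_shift k f n :
  scoef (shift k f) n = if (n < k)%N then 0 else scoef f (n - k)%N.
Proof. by []. Qed.

Lemma scoef_signM (b : bool) (f : series R) n :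
  scoef ((-1) ^+ b * f) n = (-1) ^+ b * scoef f n.
Proof. by case: b; rewrite ?expr1 ?expr0 ?mul1r ?mulN1r. Qed.

Lemma shiftM k f g : shift k (f * g) = shift k f * g.
Proof.
apply: seriesP => n; rewrite [RHS]scoefM [LHS]/=; case: ltnP => [nk|kn].
  rewrite big1 // => i _ /=; have ilt := ltn_ord i.
  by rewrite ifT ?mul0r //; lia.
rewrite -(big_mkord xpredT (fun i => scoef (shift k f) i * scoef g (n - i)%N)).
rewrite (big_cat_nat (n := k)) //=; last by lia.
rewrite [X in _ = X + _]big_nat [X in _ = X + _]big1 ?add0r => [|i /andP[_ ik]]; last by rewrite ik mul0r.
rewrite -[k in RHS]add0n big_addn subSn // big_mkord.
apply: eq_bigr => i _; rewrite add0n ltnNge leq_addl addnK.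
by congr (_ * scoef g _); lia.
Qed.

(** Deleting a copy of x turns multiplicity c + 1 into c. If x is not overlined, summing c + 1 gives
    the sign +; if it is, c is 0 or 1 and only c = 0 contributes, that is 1 - c, whence the sign
    -. *)
Lemma count_seriesE x : (0 < x.1)%N ->
  count_series x = shift x.1 (op_series + (-1) ^+ x.2 * count_series x).
Proof.
move=> x0.
apply: seriesP => n; rewrite scoef_shift scoefD scoef_signM [LHS]/=.
case: ltnP => [nx|xn].
  rewrite big_seq big1 // => s sn; rewrite (count_memPn _) //.
  by apply/negP => /(mem_overpartition_part sn); lia.
rewrite (bigID (fun s => x \in s)) /= [X in _ + X]big1 => [|s /count_memPn->//].
rewrite addr0 (big_overpartitions_mem (fun c => c%:R)) //=.
rewrite big_mkcond mulr_sumr -sum1_size natr_sum -big_split /=.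
rewrite big_seq [RHS]big_seq; apply: eq_bigr => s.
rewrite mem_overpartitions => /and4P[_ _ s_uniq _].
case x2: x.2; last by rewrite expr0 mul1r -natr1 addrC.
have -> : count_mem x s = (x \in s) :> nat.
  have := count_uniq_mem x s_uniq; rewrite count_filter mem_filter x2 => <-.
  by apply: eq_count => y /=; case: eqP => // ->; rewrite x2.
rewrite expr1 mulN1r /=; case: (x \in s) => /=; last by rewrite oppr0 addr0.
by rewrite subrr.
Qed.

(** For x = (k, b) this is q^k / (1 - (-1)^b q^k). *)
Definition geom_series x : series R := Series (fun n =>
  if (0 < n)%N && (x.1 %| n)%N then (-1) ^+ (x.2 * (n %/ x.1).-1) else 0).

Lemma geom_seriesE x : (0 < x.1)%N ->
  geom_series x = shift x.1 (1 + (-1) ^+ x.2 * geom_series x).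
Proof.
move=> x0.
apply: seriesP => n; rewrite scoef_shift scoefD scoef_signM scoef1 /=.
case: (ltnP n) => [nx|xn].
  by case: ifP => // /andP[n0 /(dvdn_leq n0)]; lia.
rewrite -{1 2 3}(subnK xn) dvdn_addl // divnDr // divnn x0 addn1.
rewrite addn_gt0 x0 orbT /=.
case: (posnP (n - x.1)) => [->|m0] /=; last rewrite add0r.
  by rewrite dvdn0 div0n /= muln0 expr0 mulr0 addr0.
case: ifP => [xm|_]; last by rewrite mulr0.
have q0 : (0 < (n - x.1) %/ x.1)%N by rewrite divn_gt0 // dvdn_leq.
by rewrite -exprD -mulnS prednK.
Qed.

(** Both sides solve f = q^k (P + (-1)^b f), which determines f coefficient by coefficient since k >
    0. *)
Lemma count_series_geom x : (0 < x.1)%N ->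
  count_series x = op_series * geom_series x.
Proof.
move=> x0.
have geoE : op_series * geom_series x =
    shift x.1 (op_series + (-1) ^+ x.2 * (op_series * geom_series x)).
  rewrite {1}geom_seriesE // mulrC -shiftM; congr shift.
  by rewrite mulrDl mul1r -mulrA [geom_series x * _]mulrC.
apply: seriesP => n; elim/ltn_ind: n => n IHn.
rewrite count_seriesE // geoE !scoef_shift.
case: ltnP => // xn; rewrite !scoefD !scoef_signM IHn //; lia.
Qed.

Definition part_sum (b : bool) s := sumn [seq x.1 | x <- s & x.2 == b].

Definition part_sum_series b : series R :=
  Series (fun n => \sum_(s <- overpartitions n) (part_sum b s)%:R).

Definition signed_sigma_series (b : bool) : series R := Series (fun n =>
  \sum_(d <- divs n) d%:R * (-1) ^+ (b * (n %/ d).-1)).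

Lemma part_sum_count b n s : s \in overpartitions n ->
  part_sum b s = (\sum_(k <- iota 1 n) k * count_mem (k, b) s)%N.
Proof.
move=> sn; have : {in s, forall x, 0 < x.1 <= n}%N.
  by move=> x; apply: mem_overpartition_part sn.
elim: s {sn} => [|x s IHs] sn.
  by rewrite big1 // => k _; rewrite muln0.
have /= xn := sn x (mem_head _ _).
under eq_bigr do rewrite /= mulnDr.
rewrite big_split -IHs => [|y ys]; last by apply: sn; rewrite in_cons ys orbT.
rewrite (bigD1_seq x.1) ?iota_uniq ?mem_iota //=.
rewrite big1_seq => [|k /andP[kx _]]; last first.
  by rewrite -pair_eqE /= [x.1 == _]eq_sym (negbTE kx) muln0.
rewrite -pair_eqE /= eqxx /part_sum /= addn0.
by case: (x.2 == b); rewrite ?muln1 ?muln0.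
Qed.

(** Weight the multiplicity of (k, b) by k and sum over k: the series k q^k / (1 - (-1)^b q^k) add
    up to a divisor sum signed by the cofactor. *)
Lemma part_sum_seriesE b :
  part_sum_series b = op_series * signed_sigma_series b.
Proof.
apply: seriesP => n /=.
transitivity (\sum_(k <- iota 1 n) k%:R * scoef (op_series * geom_series (k, b)) n).
  transitivity (\sum_(k <- iota 1 n) k%:R * scoef (count_series (k, b)) n).
    under [RHS]eq_bigr do rewrite /= mulr_sumr.
    rewrite exchange_big /=; apply: eq_big_seq => s sn.
    by rewrite (part_sum_count b sn) natr_sum; under eq_bigr do rewrite natrM.
  apply: eq_big_seq => k; rewrite mem_iota => /andP[k0 _].
  by rewrite count_series_geom.
under [LHS]eq_bigr => k _ do rewrite scoefM mulr_sumr.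
rewrite exchange_big /=; apply: eq_bigr => i _; rewrite mulr_sumr.
under eq_bigr => k _ do rewrite mulrCA.
rewrite -!mulr_sumr; congr (_ * _); set m := (n - i)%N.
(* Here k runs up to n rather than m, but divisors of m are at most m <= n. The test 0 < m matters
   since every k divides 0. *)
transitivity (\sum_(d <- [seq d <- iota 1 n | (0 < m) && (d %| m)]%N)
    d%:R * (-1) ^+ (b * (m %/ d).-1) : R).
  rewrite big_filter [RHS]big_mkcond; apply: eq_bigr => k _.
  by case: ifP; rewrite ?mulr0.
apply: perm_big; apply: uniq_perm.
- by rewrite filter_uniq ?iota_uniq.
- exact: divs_uniq.
move=> d; rewrite mem_filter mem_divs mem_iota.
case: (boolP ((0 < m) && (d %| m))%N) => //= /andP[m0 dm].
by have := dvdn_gt0 m0 dm; have := dvdn_leq m0 dm; rewrite /m; lia.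
Qed.

Lemma signed_sigma_false : signed_sigma_series false = sigma_series R 1.
Proof. by apply: seriesP => n; apply: eq_bigr => d _; rewrite mulr1. Qed.

(** The sign is negative when n / d is even, and those d are exactly the divisors of n / 2; hence A
    - 2 phi A, which is B. *)
Lemma signed_sigma_true : signed_sigma_series true = odd_sigma_series R.
Proof.
rewrite odd_sigmaE; apply: seriesP => n.
rewrite scoefD scoefN scoef_natM scoef_dilate /=.
transitivity (\sum_(d <- divs n) (d%:R ^+ 1 -
    2 * (if (2 %| n %/ d)%N then d%:R ^+ 1 else 0)) : R).
  apply: eq_big_seq => d; rewrite mem_divs => /andP[n0 dn].
  have q0 : (0 < n %/ d)%N by rewrite divn_gt0 ?(dvdn_gt0 n0 dn) // dvdn_leq.
  rewrite mul1n -signr_odd -subn1 oddB // dvdn2 addbT.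
  by case: (odd _) => /=; ring.
rewrite sumrB -mulr_sumr -big_mkcond -big_filter; congr (_ - 2 * _).
case: (boolP (2 %| n)%N) => [n2|n2].
  apply: perm_big; apply: uniq_perm; last first.
  - move=> d; rewrite mem_filter !mem_divs divn_gt0 //.
    apply/idP/idP => [/and3P[d2 n0 dn]|/andP[n0 dn]].
      by rewrite dvdn_leq // dvdn_divRL // mulnC -dvdn_divRL.
    have d_n : (d %| n)%N by rewrite (dvdn_trans dn) // dvdn_div.
    by rewrite (leq_trans _ n0) // d_n dvdn_divRL // mulnC -dvdn_divRL ?dn.
  - exact: divs_uniq.
  - by rewrite filter_uniq ?divs_uniq.
rewrite big_filter big_seq_cond big_pred0 // => d; rewrite mem_divs.
apply/negP => /andP[/andP[_ dn] d2].
by move: n2; rewrite -(divnK dn) dvdn_mulr.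
Qed.

Lemma nov_series n : (nov n)%:R = scoef (op_series * sigma_series R 1) n.
Proof.
rewrite -signed_sigma_false -part_sum_seriesE /= natr_sum.
apply: eq_bigr => s _; congr (sumn (map _ _))%:R.
by apply: eq_filter => x; case: x.2.
Qed.

Lemma ov_series n : (ov n)%:R = scoef (op_series * odd_sigma_series R) n.
Proof.
rewrite -signed_sigma_true -part_sum_seriesE /= natr_sum.
apply: eq_bigr => s _; congr (sumn (map _ _))%:R.
by apply: eq_filter => x; case: x.2.
Qed.

(** The overlined and non-overlined parts of an overpartition of n add up to n. *)
Lemma theta_op_series :
  theta op_series = op_series * (sigma_series R 1 + odd_sigma_series R).
Proof.
rewrite mulrDr; apply: seriesP => n; rewrite scoefD -nov_series -ov_series /=.
rewrite !natr_sum -big_split -sum1_size natr_sum mulr_sumr.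
apply: eq_big_seq => s sn /=; rewrite mulr1 -natrD; congr _%:R.
rewrite -(overpartition_sumn sn) /nonov_sum /ov_sum.
by elim: s {sn} => //= -[k []] s ->; rewrite /=; lia.
Qed.

End Overpartitions.

(** * Polynomial identities modulo 5 and 7 *)

Section Congruences.
Import GRing.Theory.
Local Open Scope ring_scope.

(* Below, the witness z is always the quotient by p of the difference of the two
   sides, reduced by the relation l = r if there is one. *)
Lemma modn_eq (A : pzRingType) p (z x y : A) :
  p%:R = 0 :> A -> x = y + p%:R * z -> x = y.
Proof. by move=> ->; rewrite mul0r addr0. Qed.

Lemma modn_rel_eq (A : pzRingType) p (k z l r x y : A) :
  p%:R = 0 :> A -> l = r -> x = y + k * (l - r) + p%:R * z -> x = y.
Proof. by move=> p0 ->; rewrite subrr mulr0 addr0; apply: modn_eq. Qed.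

Variable R : comNzRingType.
Local Notation S := (sigma_series R).
Local Notation P := (op_series R).

Lemma thetaX (f : series R) n :
  theta (f ^+ n.+1) = n.+1%:R * f ^+ n * theta f.
Proof.
elim: n => [|n IHn]; first by rewrite expr1 expr0 mulr1 mul1r.
by rewrite exprS thetaM IHn [n.+2%:R]mulrS [f ^+ n.+1]exprS; ring.
Qed.

(** Here u is the logarithmic derivative of P, in whatever form suits the computation; polynomial
    multiples of P thus stay of that form under theta. *)
Lemma theta_op_seriesM u f :
  S 1 + odd_sigma_series R = u -> theta (P * f) = P * (u * f + theta f).
Proof. by move=> <-; rewrite thetaM theta_op_series -mulrA -mulrDr. Qed.

(** The first congruence, with multiplication of the n-th coefficient by n written as theta. *)
Lemma nov_ov_mod5 : 5%:R = 0 :> R ->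
  theta (P * S 1) + 2 * (P * S 1) =
  theta (theta (P * odd_sigma_series R)) + 4 * theta (P * odd_sigma_series R)
  + 3 * (P * odd_sigma_series R).
Proof.
move=> /series_nat0 p0.
have E := sigma1_sqr R; have B := odd_sigmaE R.
set a := S 1 in E B *; set c := S 3 in E; set b := dilate a in B.
(* Modulo 5 the term 5 c drops out and the rest reads 2 a^2 = a - theta a. *)
have theta_a : theta a = a - 2 * a ^+ 2.
  by apply: (modn_rel_eq (k := 1) (z := c - 2 * a ^+ 2 - theta a) p0 E); ring.
have theta_b : theta b = 2 * b - 4 * b ^+ 2.
  rewrite theta_dilate theta_a !expr2.
  by rewrite dilateD dilateN dilate_natM dilateM -/b; ring.
have theta_P f : theta (P * f) = P * ((2 * a - 2 * b) * f + theta f).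
  by apply: theta_op_seriesM; rewrite -/a B; ring.
have ov1 : theta (P * (a - 2 * b)) = P * (a + b - a * b + 2 * b ^+ 2).
  rewrite theta_P thetaD thetaN theta_natM theta_a theta_b.
  by apply: (modn_eq (z := P * (2 * b ^+ 2 - a * b - b)) p0); ring.
have ov2 : theta (P * (a + b - a * b + 2 * b ^+ 2)) =
    P * (a + 2 * b + 2 * a * b + 2 * b ^+ 2).
  rewrite theta_P !(theta_nat, thetaD, thetaN, thetaM, thetaX) theta_a theta_b.
  apply: (modn_eq (z := P * (2 * a * b ^+ 2 - a * b - 4 * b ^+ 3)) p0).
  by ring.
rewrite B ov1 ov2 theta_P theta_a.
by apply: (modn_eq (z := - P * (a + 2 * b ^+ 2)) p0); ring.
Qed.

Lemma nov_ov_mod7 : 7%:R = 0 :> R -> S 7 = S 1 ->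
  theta (theta (P * S 1)) + P * S 1 =
  4 * theta (theta (theta (P * odd_sigma_series R)))
  - theta (theta (P * odd_sigma_series R)) - P * odd_sigma_series R.
Proof.
move=> /series_nat0 p0 S71.
have E1 := sigma3_sqr R; have E2 := sigma1_sigma3 R.
have E3 := odd_sigma_sqr R; have B := odd_sigmaE R.
rewrite S71 in E1.
set a := S 1 in E1 E2 B *; set c := S 3 in E1 E2 E3.
set b := odd_sigma_series R in E3 B *; set d := dilate c in E3.
(* Since 120 = 1 modulo 7, [E1] reads c^2 = a - c. *)
have aE : a = c + c ^+ 2.
  by apply: (modn_rel_eq (k := -1) (z := 17 * c ^+ 2) p0 E1); ring.
(* The coefficient 21 of [S 5] vanishes modulo 7, and 4 inverts the coefficient 30 = 2 of theta
   c. *)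
have theta_c : theta c = c + 2 * c ^+ 2 - c ^+ 3.
  rewrite aE in E2; apply: (modn_rel_eq (k := 4) (z := 5 * c - 138 * c ^+ 2
    - 137 * c ^+ 3 + 12 * S 5 - 17 * theta c) p0 E2).
  by ring.
have theta_d : theta d = 2 * d + 4 * d ^+ 2 - 2 * d ^+ 3.
  rewrite theta_dilate theta_c !expr2 exprS expr2.
  by rewrite !(dilateD, dilateN, dilate_natM, dilateM) -/d; ring.
have bE : b = c + c ^+ 2 - 2 * (d + d ^+ 2).
  by rewrite B aE dilateD expr2 dilateM.
(* As 240 = 2 modulo 7, x is the reduction of E4 = 1 + 240 C and y is phi x. This change of variable
   completes the square in a and leaves only constant and cubic terms in theta x. *)
pose x := 1 + 2 * c; pose y := 1 + 2 * d.
have theta_x : theta x = 2 - 2 * x ^+ 3.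
  rewrite thetaD (theta_nat R 1) theta_natM theta_c /x.
  by apply: (modn_eq (z := 2 * c + 4 * c ^+ 2 + 2 * c ^+ 3) p0); ring.
have theta_y : theta y = 3 * y ^+ 3 - 3.
  rewrite thetaD (theta_nat R 1) theta_natM theta_d /y.
  by apply: (modn_eq (z := - (2 * d + 4 * d ^+ 2 + 4 * d ^+ 3)) p0); ring.
(* The evaluation of B^2 rewritten in x and y. *)
have xy : y ^+ 4 - x ^+ 2 * y ^+ 2 + 2 * x ^+ 4 + x - 3 * y = 0.
  rewrite bE in E3; apply: (modn_rel_eq (k := 5) (z :=
      - 4 * c ^+ 4 - 8 * c ^+ 3 + 32 * c ^+ 2 * d ^+ 2
      + 32 * c ^+ 2 * d - 3 * c ^+ 2 + 32 * c * d ^+ 2 + 32 * c * d + 2 * c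
      - 32 * d ^+ 4 - 64 * d ^+ 3 - 30 * d ^+ 2 + 4 * d) p0 E3).
  by rewrite /x /y; ring.
have ax : a = 2 * x ^+ 2 - 2.
  by rewrite aE /x; apply: (modn_eq (z := - (c + c ^+ 2)) p0); ring.
have bxy : b = 2 * x ^+ 2 + 3 * y ^+ 2 + 2.
  rewrite bE /x /y.
  by apply: (modn_eq (z := - (1 + c + c ^+ 2 + 2 * d + 2 * d ^+ 2)) p0); ring.
have theta_P f : theta (P * f) = P * ((3 * y ^+ 2 - 3 * x ^+ 2) * f + theta f).
  apply: theta_op_seriesM; rewrite -/a -/b ax bxy.
  by apply: (modn_eq (z := x ^+ 2) p0); ring.
(* From here on [ring] treats x and y as indeterminates. *)
clearbody x y; clear - p0 theta_x theta_y xy ax bxy theta_P.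
pose thetaE := (theta_nat, thetaD, thetaN, thetaM, thetaX).
(* Theta is needed twice for [nov] and three times for [ov], after the degrees in n; each
   application yields P times a polynomial in x and y reduced modulo 7. *)
have nov1 : theta (P * (2 * x ^+ 2 - 2)) =
    P * (- x ^+ 2 * y ^+ 2 - x ^+ 2 + x + y ^+ 2).
  rewrite theta_P !thetaE theta_x.
  apply: (modn_eq (z := P * (- 2 * x ^+ 4 + x ^+ 2 * y ^+ 2 + x ^+ 2 + x
    - y ^+ 2)) p0).
  by ring.
have nov2 : theta (P * (- x ^+ 2 * y ^+ 2 - x ^+ 2 + x + y ^+ 2)) =
    P * (2 * x ^+ 3 - 2 * x ^+ 2 * y ^+ 4 + x ^+ 2 * y ^+ 2 - x ^+ 2 * y
         - x * y ^+ 2 + 3 * x + 2 * y ^+ 4 + y + 2).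
  rewrite theta_P !thetaE theta_x theta_y.
  apply: (modn_eq (z := P * (x ^+ 4 * y ^+ 2 + x ^+ 4 - x ^+ 3
    - x ^+ 2 * y ^+ 4 - x ^+ 2 * y ^+ 2 + x ^+ 2 * y - x + y ^+ 4 - y)) p0).
  by ring.
have ov1 : theta (P * (2 * x ^+ 2 + 3 * y ^+ 2 + 2)) =
    P * (- 3 * x ^+ 2 * y ^+ 2 + x ^+ 2 + x - y ^+ 4 - y ^+ 2 + 3 * y).
  rewrite theta_P !thetaE theta_x theta_y.
  apply: (modn_eq (z := P * (- 2 * x ^+ 4 - x ^+ 2 + x + 4 * y ^+ 4 + y ^+ 2
    - 3 * y)) p0).
  by ring.
have ov2 : theta (P * (- 3 * x ^+ 2 * y ^+ 2 + x ^+ 2 + x - y ^+ 4 - y ^+ 2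
                       + 3 * y)) =
    P * (2 * x ^+ 3 - 3 * x ^+ 2 * y ^+ 4 - x ^+ 2 * y ^+ 2 + 2 * x ^+ 2 * y
         - 2 * x * y ^+ 2 - 3 * x - y ^+ 6 - 2 * y ^+ 4 + 2 * y ^+ 3 - y).
  rewrite theta_P !thetaE theta_x theta_y.
  apply: (modn_eq (z := P * (3 * x ^+ 4 * y ^+ 2 - x ^+ 4 - x ^+ 3
    - 3 * x ^+ 2 * y ^+ 4 + x ^+ 2 * y ^+ 2 + x ^+ 2 * y - x * y ^+ 2 + x
    - 2 * y ^+ 6 - y ^+ 4 + 4 * y ^+ 3 + y - 1)) p0).
  by ring.
have ov3 : theta (P * (2 * x ^+ 3 - 3 * x ^+ 2 * y ^+ 4 - x ^+ 2 * y ^+ 2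
      + 2 * x ^+ 2 * y - 2 * x * y ^+ 2 - 3 * x - y ^+ 6 - 2 * y ^+ 4
      + 2 * y ^+ 3 - y)) =
    P * (3 * x ^+ 5 + 2 * x ^+ 3 * y ^+ 2 + x ^+ 3 - 3 * x ^+ 2 * y ^+ 4
         + 2 * x ^+ 2 * y - x ^+ 2 - 2 * x * y ^+ 4 + x * y ^+ 2 - x * y
         - 2 * y ^+ 6 - 3 * y ^+ 3 - y ^+ 2 - 3).
  rewrite theta_P !thetaE theta_x theta_y.
  apply: (modn_eq (z := P * (- 3 * x ^+ 5 + 3 * x ^+ 4 * y ^+ 4
    + x ^+ 4 * y ^+ 2 - 2 * x ^+ 4 * y + 2 * x ^+ 3 * y ^+ 2 + 2 * x ^+ 3
    - 6 * x ^+ 2 * y ^+ 6 + 6 * x ^+ 2 * y ^+ 3 + x ^+ 2 * y + x ^+ 2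
    - 4 * x * y ^+ 4 - 2 * x * y ^+ 2 + 3 * x * y - 3 * y ^+ 8 - 4 * y ^+ 6
    + 6 * y ^+ 5 + 3 * y ^+ 3 - 3 * y ^+ 2)) p0).
  by ring.
rewrite ax bxy nov1 nov2 ov1 ov2 ov3.
(* Modulo 7 the two sides differ by [P * x] times the left side of [xy]. *)
apply: (modn_rel_eq (k := P * x) (z := P * (- 2 * x ^+ 5 - x ^+ 3 * y ^+ 2
  + x ^+ 2 * y ^+ 4 - x ^+ 2 * y + x ^+ 2 + x * y ^+ 4 - x * y ^+ 2 + x * y
  + y ^+ 6 + 2 * y ^+ 3 + y ^+ 2 + 2)) p0 xy).
by ring.
Qed.

Lemma nov_ov_coef_mod5 n : 5%:R = 0 :> R ->
  (n%:R + 2) * (nov n)%:R = (n%:R ^+ 2 + 4 * n%:R + 3) * (ov n)%:R :> R.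
Proof.
move=> /nov_ov_mod5/(congr1 (fun f => scoef f n)).
rewrite !(scoefD, scoef_natM, scoef_theta) -nov_series -ov_series => E.
by rewrite mulrDl E; ring.
Qed.

Lemma nov_ov_coef_mod7 n : 7%:R = 0 :> R -> S 7 = S 1 ->
  (n%:R ^+ 2 + 1) * (nov n)%:R =
  (4 * n%:R ^+ 3 - n%:R ^+ 2 - 1) * (ov n)%:R :> R.
Proof.
move=> p0 /(nov_ov_mod7 p0)/(congr1 (fun f => scoef f n)).
rewrite !(scoefD, scoefN, scoef_natM, scoef_theta) -nov_series -ov_series => E.
by rewrite mulrDl expr2 -mulrA mul1r E; ring.
Qed.

End Congruences.

(** * From prime fields to congruences between integers *)

Section Transfer.
Import GRing.Theory.
Local Open Scope ring_scope.

Lemma eqz_mod_Fp p (a b : int) : prime p ->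
  a%:~R = b%:~R :> 'F_p -> (a = b %[mod p])%Z.
Proof.
move=> p_prime ab; apply/eqP.
by rewrite eqz_mod_dvd (dvdz_pcharf (pchar_Fp p_prime)) rmorphB /= ab subrr.
Qed.

Lemma sigma_series_Fermat p :
  prime p -> sigma_series 'F_p p = sigma_series 'F_p 1.
Proof.
move=> p_prime; apply: eq_lambert => d _.
exact: pFrobenius_aut_nat (pchar_Fp p_prime) d.
Qed.

End Transfer.

Theorem theorem1p2 (n : nat) :
  ((n%:Z + 2) * (nov n)%:Z = (n%:Z ^+ 2 + 4 * n%:Z + 3) * (ov n)%:Z %[mod 5])%Z /\
  ((n%:Z ^+ 2 + 1) * (nov n)%:Z = (4 * n%:Z ^+ 3 - n%:Z ^+ 2 - 1) * (ov n)%:Z %[mod 7])%Z.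
Proof.
split; apply: eqz_mod_Fp => //.
  rewrite !(GRing.rmorphM, GRing.rmorphD, GRing.rmorphXn, GRing.rmorph_nat) /= -!pmulrn.
  exact: nov_ov_coef_mod5 (pchar_Fp_0 _).
rewrite !(GRing.rmorphM, GRing.rmorphB, GRing.rmorphD, GRing.rmorphXn, GRing.rmorph_nat, GRing.rmorph1) /= -!pmulrn.
apply: nov_ov_coef_mod7; first exact: pchar_Fp_0.
exact: sigma_series_Fermat.
Qed.
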